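(* Let $k\geq 3$ and $n\geq 1$ be integers. Then \[ \mathrm{R}(W_k^{\otimes n})\;\geq\;(k-1)2^n+\max_{m\geq 1}\Biggl[\,\sum_{b=0}^{2m-2}\binom{n}{b}-2\sum_{b=0}^{m-1}\binom{n}{b}\Biggr]-(k-3)\;\geq\; k\cdot 2^n-o(2^n), \] where the maximum is over integers $m\ge1$, and the last inequality is asymptotic as $n\to\infty$ with $k$ fixed.
   Context: Let $V_1,\ldots,V_k$ be finite-dimensional complex vector spaces. A tensor in $V_1\otimes\cdots\otimes V_k$ of the form $v_1\otimes\cdots\otimes v_k$ is called simple. The tensor rank $\mathrm{R}(t)$ of $t\in V_1\otimes\cdots\otimes V_k$ is the smallest number $r$ such that $t$ is a sum of $r$ simple tensors. Let $e_0,e_1$ be the standard basis of $\mathbb{C}^2$. The generalised W-state tensor is \[ W_k = e_1\otimes e_0\otimes\cdots\otimes e_0+e_0\otimes e_1\otimes\cdots\otimes e_0+\cdots+e_0\otimes\cdots\otimes e_0\otimes e_1\in(\mathbb{C}^2)^{\otimes k}. \] The tensor Kronecker product of $k$-tensors $s\in U_1\otimes\cdots\otimes U_k$ and $t\in V_1\otimes\cdots\otimes V_k$ is $s\otimes t$ regarded as a $k$-tensor in $(U_1\otimes V_1)\otimes\cdots\otimes(U_k\otimes V_k)$. $W_k^{\otimes n}$ denotes the $n$-fold tensor Kronecker product, a $k$-tensor in $(\mathbb{C}^{2^n})^{\otimes k}$, where each factor $\mathbb{C}^{2^n}$ is identified with $(\mathbb{C}^2)^{\otimes n}$. Convention: $\binom{n}{b}=0$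 for $b>n$. *)

(* Defs.v *)
From HB Require Import structures.
From mathcomp Require Import all_boot all_order all_algebra.
From mathcomp Require Import boolp classical_sets.

Set Implicit Arguments.
Unset Strict Implicit.
Unset Printing Implicit Defensive.

Import Order.TTheory GRing.Theory Num.Theory.

Local Open Scope ring_scope.

(** The vector space [V_i] is given in coordinates as [{ffun I i -> F}], with
    [I i] a finite type indexing a basis.  An element of
    [V_0 (x) ... (x) V_(k-1)] is its array of coordinates in the product basis,
    indexed by the multi-indices [x] with [x i : I i]. *)
Section Tensors.
Variables (F : fieldType) (k : nat).

Definition tensor (I : 'I_k -> finType) :=
  {ffun {dffun forall i : 'I_k, I i} -> F}.

Definition tprod (I : 'I_k -> finType) (v : forall i, {ffun I i -> F}) :
    tensor I :=
  [ffun x : {dffun forall i : 'I_k, I i} => \prod_(i < k) v i (x i)].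

Definition simple_tensor (I : 'I_k -> finType) (t : tensor I) : Prop :=
  exists v : forall i, {ffun I i -> F}, t = tprod v.

Definition sum_of_simple (I : 'I_k -> finType) (t : tensor I) (r : nat) : Prop :=
  exists s : 'I_r -> tensor I,
    (forall j, simple_tensor (s j)) /\ t = \sum_(j < r) s j.

(** The value [0] of the second branch is only reached when [k = 0], see
    [tensor_rankP]. *)
Definition tensor_rank (I : 'I_k -> finType) (t : tensor I) : nat :=
  match pselect (exists r, `[< sum_of_simple t r >]) with
  | left h => ex_minn h
  | right _ => 0%N
  end.

Definition kron_index (I J : 'I_k -> finType) : 'I_k -> finType :=
  fun i => (I i * J i)%type.

Definition kron (I J : 'I_k -> finType) (s : tensor I) (t : tensor J) :
    tensor (kron_index I J) :=
  [ffun x : {dffun forall i, kron_index I J i} =>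
     s [ffun i => (x i).1] * t [ffun i => (x i).2]].

(** The [n]-fold product is [t (x) (t (x) ... (t (x) 1))], where [1] is the unit
    tensor, all of whose factors are one-dimensional. *)
Fixpoint kron_exp_index (I : 'I_k -> finType) (n : nat) : 'I_k -> finType :=
  if n is n'.+1 then kron_index I (kron_exp_index I n') else fun=> unit.

Fixpoint kron_exp (I : 'I_k -> finType) (t : tensor I) (n : nat) :
    tensor (kron_exp_index I n) :=
  match n return tensor (kron_exp_index I n) with
  | 0 => [ffun=> 1]
  | n'.+1 => kron t (kron_exp t n')
  end.

Definition basis2 (a : 'I_2) : {ffun 'I_2 -> F} := [ffun c => (c == a)%:R].

Definition W_tensor : tensor (fun _ : 'I_k => 'I_2) :=
  \sum_(i < k) tprod (fun j => basis2 (if j == i then 1 else 0)).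

Lemma tensor_sum_of_simple (I : 'I_k -> finType) (t : tensor I) :
  (0 < k)%N -> exists r, sum_of_simple t r.
Proof.
move=> k_gt0; pose i0 : 'I_k := Ordinal k_gt0.
pose T := {dffun forall i : 'I_k, I i}.
pose v (y : T) (i : 'I_k) : {ffun I i -> F} :=
  [ffun c => (if i == i0 then t y else 1) * (c == y i)%:R].
exists #|T|, (fun j => tprod (v (enum_val j))); split; first by move=> j; eexists.
apply/ffunP=> x; rewrite sum_ffunE.
rewrite (reindex_onto (@enum_rank T) (@enum_val T predT)) /=; last first.
  by move=> j _; rewrite enum_valK.
rewrite (eq_bigl predT); last by move=> y; rewrite enum_rankK eqxx.
rewrite (bigD1 x) //= big1 ?addr0; last first.
  move=> y y_neq; rewrite enum_rankK ffunE.
  have [i xy_i] : exists i, x i != y i.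
    apply/existsP; apply: contraNT y_neq; rewrite negb_exists => /forallP xy.
    by apply/eqP/ffunP=> i; apply/esym/eqP; have := xy i; rewrite negbK.
  by rewrite (bigD1 i) //= ffunE (negbTE xy_i) mulr0 mul0r.
rewrite enum_rankK ffunE (bigD1 i0) //= ffunE !eqxx mulr1 big1 ?mulr1 //.
by move=> i /negbTE i_neq; rewrite ffunE i_neq eqxx mulr1.
Qed.

Lemma tensor_rankP (I : 'I_k -> finType) (t : tensor I) : (0 < k)%N ->
  sum_of_simple t (tensor_rank t) /\
  forall r, sum_of_simple t r -> (tensor_rank t <= r)%N.
Proof.
move=> k_gt0; rewrite /tensor_rank; case: pselect => [h|]; last first.
  have [r tr] := tensor_sum_of_simple t k_gt0.
  by case; exists r; apply/asboolP.
case: ex_minnP => r /asboolP tr rmin; split=> // r' tr'.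
by apply: rmin; apply/asboolP.
Qed.

End Tensors.

(** Meant for [m >= 1], where the truncated subtractions are exact. *)
Definition binom_gap (n m : nat) : int :=
  (\sum_(0 <= b < (2 * m - 2).+1) 'C(n, b))%:Z
  - 2 * (\sum_(0 <= b < (m - 1).+1) 'C(n, b))%:Z.

Definition is_max (A : set int) (M : int) : Prop := A M /\ ubound A M.

Definition W_bound (k n : nat) (M : int) : int :=
  (k%:Z - 1) * 2 ^+ n + M - (k%:Z - 3).

(* Main.v *)
(** Index the coordinates of each factor by the subsets of [n]: the tensor is
    then 1 on the k-tuples of sets partitioning [n] and 0 elsewhere, i.e. it is
    the form "top coefficient of the product x_1 ... x_k" on the local algebra
    C[t_1, ..., t_n]/(t_1^2, ..., t_n^2), with maximal ideal I.  Given a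
    decomposition into r simple tensors, one kills, factor after factor, as many
    terms as I^(m_j) has dimensions, by restricting the j-th argument to a
    complement of I^(m_j); here m_j = m for two factors and 1 for k - 3 others.
    There are always enough terms left, since the restricted arguments still
    contain elements with any given leading monomial of degree < m_j, so that
    the form stays nondegenerate.  For the same reason the surviving terms
    separate, in the last factor, the elements of degree >= n - (2m - 2).
    Asymptotically m = n/3 + 1 is good enough, by Chebyshev's inequality. *)
Require Import Defs.
From HB Require Import structures.
From mathcomp Require Import all_boot all_order all_algebra.
From mathcomp Require Import zify ring boolp.

Set Implicit Arguments.
Unset Strict Implicit.
Unset Printing Implicit Defensive.

Import Order.TTheory GRing.Theory Num.Theory.

Local Open Scope ring_scope.

(** * Selection of functionals by linear algebra *)

Section Selection.
Variables (F : fieldType) (B : finType) (r : nat) (phi : 'I_r -> B -> F).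

(* [A'] picks functionals that restrict to a basis of the dual of the space of
   vectors supported on [D]; their common kernel is then a complement of it. *)
Lemma select_complement (D : {set B}) (A : {set 'I_r}) :
    (forall w : B -> F, (forall S, S \notin D -> w S = 0) ->
       (forall i, i \in A -> \sum_S w S * phi i S = 0) -> forall S, w S = 0) ->
  exists A' : {set 'I_r}, [/\ A' \subset A, #|A'| = #|D| &
    forall a : B -> F, exists x : B -> F,
      (forall S, S \notin D -> x S = a S) /\
      (forall i, i \in A' -> \sum_S x S * phi i S = 0)].
Proof.
move=> phi_inj.
pose M : 'M[F]_(#|A|, #|D|) := \matrix_(i, d) phi (enum_val i) (enum_val d).
pose ext (v : 'I_#|D| -> F) S := \sum_d v d * (S == enum_val d)%:R.
have ext_out v S : S \notin D -> ext v S = 0.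
  move=> SD; rewrite /ext big1 // => d _.
  case: eqP => [Sd|_]; last by rewrite mulr0.
  by move: SD; rewrite Sd enum_valP.
have ext_in v d : ext v (enum_val d) = v d.
  rewrite /ext (bigD1 d) //= eqxx mulr1 big1 ?addr0 // => e ed.
  by rewrite (inj_eq enum_val_inj) eq_sym (negbTE ed) mulr0.
have ext_phi v i : \sum_S ext v S * phi i S = \sum_d v d * phi i (enum_val d).
  rewrite /ext; under eq_bigr => S _ do rewrite mulr_suml.
  rewrite exchange_big /=; apply: eq_bigr => d _.
  rewrite (bigD1 (enum_val d)) //= eqxx mulr1 big1 ?addr0 // => S /negbTE Sd.
  by rewrite Sd mulr0 mul0r.
have fullM : row_full M.
  rewrite /row_full -mxrank_tr; apply: inj_row_free => v vM0.
  have v0 := phi_inj (ext (v 0)) (ext_out (v 0)).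
  apply/rowP=> d; rewrite mxE -[v 0 d](ext_in (v 0)); apply: v0 => i iA.
  move/rowP/(_ (enum_rank_in iA i)): vM0; rewrite !mxE => vM0.
  rewrite ext_phi -[RHS]vM0; apply: eq_bigr => e _.
  by rewrite !mxE enum_rankK_in.
(* By [phi_inj], [M] has full column rank, so [g] selects rows that form an invertible square matrix
   [N]. *)
pose g := fullrankfun fullM.
have unitN := fullrowsub_unit fullM; set N := rowsub _ _ in unitN.
have g_inj : injective (fun d => enum_val (g d)).
  by move=> d e /enum_val_inj; apply: fullrankfun_inj.
exists [set enum_val (g d) | d in [set: 'I_#|D|]]; split.
- by apply/subsetP=> _ /imsetP[d _ ->]; apply: enum_valP.
- by rewrite card_imset // cardsT card_ord.
(* The vector sought is [a] off [D] plus a correction on [D], found by solving a linear system with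
   matrix [N]. *)
move=> a; pose a' S := if S \in D then 0 else a S.
pose b : 'cV[F]_#|D| := \col_d - \sum_S a' S * phi (enum_val (g d)) S.
pose w := invmx N *m b.
exists (fun S => a' S + ext (w^~ 0) S); split=> [S SD|_ /imsetP[d _ ->]].
  by rewrite ext_out // addr0 /a' (negbTE SD).
under eq_bigr => S _ do rewrite mulrDl.
rewrite big_split ext_phi /=.
have /colP/(_ d) := mulKVmx unitN b; rewrite !mxE => Nwb.
apply/eqP; rewrite addrC addr_eq0 -Nwb; apply/eqP/eq_bigr => e _.
by rewrite !mxE mulrC.
Qed.

End Selection.

(** * Exact covers, and killing the terms of a decomposition *)

Section Core.
Variables (F : fieldType) (k n : nat).
Local Notation B := {set 'I_n}.

Definition exact_cover (S : 'I_k -> B) : bool :=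
  [forall l, (\sum_(j < k) (l \in S j))%N == 1%N].

Lemma exact_cover_fibers (g : 'I_n -> 'I_k) :
  exact_cover (fun j => [set l | g l == j]).
Proof.
apply/forallP=> l; apply/sum_nat_eq1; exists (g l); split=> //.
  by rewrite inE eqxx.
by move=> j jg _; rewrite inE eq_sym (negbTE jg).
Qed.

Lemma exact_cover_card (S : 'I_k -> B) :
  exact_cover S -> (\sum_(j < k) #|S j|)%N = n.
Proof.
move=> /forallP cS; under eq_bigr => j _ do rewrite -sum1_card big_mkcond.
rewrite exchange_big /=; under eq_bigr => l _.
  under eq_bigr => j _ do rewrite -[if _ then _ else _]/(nat_of_bool _).
  rewrite (eqP (cS l)); over.
by rewrite sum1_card card_ord.
Qed.

Lemma exact_cover_inj (j0 : 'I_k) (S S' : 'I_k -> B) :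
  exact_cover S -> exact_cover S' -> (forall j, j != j0 -> S j = S' j) ->
  S j0 = S' j0.
Proof.
move=> /forallP cS /forallP cS' SS'; apply/setP=> l.
have := cS l; rewrite -(eqP (cS' l)) (bigD1 j0) //.
rewrite [in X in _ == X](bigD1 j0) //=.
rewrite (eq_bigr (fun j => (l \in S' j) : nat)) => [|j /SS' -> //].
by rewrite eqn_add2r; do 2!case: (_ \in _).
Qed.

Variables (r : nat) (f : 'I_r -> 'I_k -> B -> F).
Hypothesis f_cover : forall S : 'I_k -> B,
  \sum_i \prod_j f i j (S j) = (exact_cover S)%:R.

Lemma cover_form (x : 'I_k -> B -> F) :
  \sum_i \prod_j \sum_S x j S * f i j S
    = \sum_(S : {ffun 'I_k -> B}) (exact_cover S)%:R * \prod_j x j (S j).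
Proof.
under eq_bigr => i _ do rewrite bigA_distr_bigA.
rewrite exchange_big /=; apply: eq_bigr => S _.
rewrite -f_cover mulr_suml; apply: eq_bigr => i _.
by rewrite big_split mulrC.
Qed.

(* Sizes in an exact cover add up to n, so only terms of lowest degree can
   contribute.  One factor, [p], may have several of them: its set is determined
   by those of the other factors. *)
Lemma cover_form_lowest (p : 'I_k) (C : 'I_k -> B) (x : 'I_k -> B -> F) :
    exact_cover C ->
    (forall j (S : B), (#|S| < #|C j|)%N -> x j S = 0) ->
    (forall j (S : B), j != p -> #|S| = #|C j| -> S != C j -> x j S = 0) ->
  \sum_i \prod_j \sum_S x j S * f i j S = \prod_j x j (C j).
Proof.
move=> cC x_lt x_eq.
rewrite cover_form (bigD1 (finfun C)) //= [X in _ + X]big1 ?addr0.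
  have -> : exact_cover (finfun C) = exact_cover C.
    apply: eq_forallb => l; congr (_ == _).
    by apply: eq_bigr => j _; rewrite ffunE.
  by rewrite cC mul1r; apply: eq_bigr => j _; rewrite ffunE.
move=> S SC; case cS: (exact_cover S); last by rewrite mul0r.
rewrite mul1r; apply/eqP/prodf_eq0/exists_inP; apply: contraNT SC.
rewrite negb_exists => /forallP x_neq0.
have le (j : 'I_k) : (#|C j| <= #|S j|)%N.
  by rewrite leqNgt; apply: contraNN (x_neq0 j) => /x_lt ->; rewrite eqxx.
have eq (j : 'I_k) : #|S j| = #|C j|.
  have [_] := leqif_sum (fun j (_ : predT j) => leqif_eq (le j)).
  by rewrite !exact_cover_card // eqxx => /esym/forallP/(_ j)/eqP.
have SC (j : 'I_k) : j != p -> S j = C j.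
  move=> jp; apply/eqP; apply: contraNT (x_neq0 j) => SCj.
  by rewrite x_eq ?eqxx.
apply/eqP/ffunP=> j; rewrite ffunE; have [->|/SC//] := eqVneq j p.
exact: exact_cover_inj cS cC SC.
Qed.

Variable m : 'I_k -> nat.
Local Notation D j := [set S : B | (m j <= #|S|)%N].

(* [X j C] is the basis vector [C] corrected by terms of degree at least [m j];
   for [j] in [s] it is killed by the [j]-th factors of the terms chosen for
   [j]. *)
Definition killing (s : seq 'I_k) (T : {set 'I_r})
    (X : 'I_k -> B -> B -> F) : Prop :=
  (forall j C (S : B), (#|S| < m j)%N -> X j C S = (S == C)%:R) /\
  (forall i, i \in T ->
     exists2 j, j \in s & forall C, \sum_S X j C S * f i j S = 0).

(** Otherwise complete a smallest set [S0] in the support of [w] to an exact cover [C]. With [w] in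
    slot [p] and [X j (C j)] elsewhere, the form takes the value [w S0], although every term
    vanishes: those in [T] by [killing], the others by [w_kill]. *)
Lemma killing_nondegenerate s T X (p : 'I_k) (E : {set B}) (w : B -> F) :
    killing s T X -> p \notin s ->
    (forall S, S \in E -> exists C, [/\ exact_cover C, C p = S &
       forall j, j != p -> (#|C j| < m j)%N]) ->
    (forall S, S \notin E -> w S = 0) ->
    (forall i, i \in ~: T -> \sum_S w S * f i p S = 0) ->
  forall S, w S = 0.
Proof.
move=> [X_low X_kill] ps E_cover w_out w_kill S1; apply/eqP/negPn/negP=> wS1.
case: (@arg_minnP _ S1 (fun S => w S != 0) (fun S : B => #|S|) wS1).
move=> S0 wS0 S0_min.
have S0E : S0 \in E by apply: contraNT wS0 => /w_out ->.
have [C [cC Cp Cm]] := E_cover _ S0E.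
pose x j := if j == p then w else X j (C j).
have lowest : \sum_i \prod_j \sum_S x j S * f i j S = \prod_j x j (C j).
  apply: (@cover_form_lowest p) => // j S; rewrite /x;
    have [->|jp] := eqVneq j p.
  - by rewrite Cp ltnNge => SS0; apply/eqP; apply: contraNT SS0 => /S0_min.
  - move=> SC; rewrite X_low ?(ltn_trans SC) ?Cm //.
    by case: eqP => // SCj; rewrite SCj ltnn in SC.
  - by [].
  - by move=> _ SC /negbTE nSC; rewrite X_low ?nSC ?SC ?Cm.
suff: \prod_j x j (C j) == 0.
  apply/negP/prodf_neq0 => j _; rewrite /x; have [->|jp] := eqVneq j p.
    by rewrite Cp.
  by rewrite X_low ?Cm // eqxx oner_eq0.
rewrite -lowest big1 // => i _; apply/eqP/prodf_eq0.
have [iT|iT] := boolP (i \in T).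
  have [j js j_kill] := X_kill i iT; exists j => //.
  rewrite /x; case: (eqVneq j p) => [jp|_]; last by rewrite j_kill.
  by rewrite -jp js in ps.
by exists p => //; rewrite /x eqxx w_kill ?inE.
Qed.

(** Induction on [s]: by nondegeneracy in slot [p], the terms still alive separate the vectors
    supported on [D p], so [#|D p|] more of them can be killed there. *)
Lemma killing_exists (p0 : 'I_k) (s : seq 'I_k) :
    (forall j, 0 < m j)%N -> (n < m p0)%N -> uniq s -> p0 \notin s ->
  exists T X, killing s T X /\ #|T| = (\sum_(j <- s) #|D j|)%N.
Proof.
move=> m_gt0 m_p0; elim: s => [|p s IHs] /=.
  exists set0, (fun _ C S => (S == C)%:R); rewrite cards0 big_nil.
  by split=> //; split=> // i; rewrite inE.
case/andP=> ps us; rewrite inE negb_or => /andP[p0p p0s].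
have [T [X [TX cardT]]] := IHs us p0s.
have D_cover S : S \in D p -> exists C, [/\ exact_cover C, C p = S &
    forall j, j != p -> (#|C j| < m j)%N].
  (* Slot [p0] absorbs the complement of [S], whatever its size, because [m p0] exceeds [n]. *)
  move=> _; pose g l := if l \in S then p else p0.
  exists (fun j => [set l | g l == j]); split; first exact: exact_cover_fibers.
    by apply/setP=> l; rewrite inE /g; case: ifP; rewrite ?eqxx // (negbTE p0p).
  move=> j jp; have [->|jp0] := eqVneq j p0.
    by apply: leq_ltn_trans m_p0; rewrite -[X in (_ <= X)%N]card_ord max_card.
  rewrite (_ : [set _ | _] = set0) ?cards0 //; apply/setP=> l; rewrite !inE /g.
  by case: ifP => _; rewrite eq_sym ?(negbTE jp) ?(negbTE jp0).
have [T' [T'T cardT' T'_sel]] :=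
  select_complement
    (fun w => @killing_nondegenerate _ _ _ _ _ w TX ps D_cover).
case: TX => X_low X_kill.
have [Y Y_sel] : exists Y : B -> B -> F, forall C,
    (forall S, S \notin D p -> Y C S = (S == C)%:R) /\
    (forall i, i \in T' -> \sum_S Y C S * f i p S = 0).
  have [Y HY] := choice (fun C : B => T'_sel (fun S => (S == C)%:R)).
  by exists Y => C; apply: HY.
exists (T :|: T'), (fun j => if j == p then Y else X j).
rewrite big_cons -cardT -cardT' cardsU.
rewrite (_ : T :&: T' = set0) ?cards0 ?subn0; last first.
  by apply/eqP; rewrite setI_eq0 disjoint_sym -[T]setCK -subsets_disjoint.
split; last by rewrite addnC.
split=> [j C S Sm|i]; rewrite ?inE.
  case: eqP => [jp|_]; last by rewrite X_low.
  by rewrite (Y_sel C).1 // inE -jp -ltnNge.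
case/orP=> [/X_kill[j js j_kill]|iT'].
  exists j => [|C]; rewrite ?inE ?js ?orbT //; case: eqP => // jp.
  by rewrite jp (negbTE ps) in js.
by exists p => [|C]; rewrite ?inE eqxx //; apply: (Y_sel C).2.
Qed.

(** After killing in all slots but [p0], the surviving terms still separate the vectors supported on
    [E], which takes at least [#|E|] of them. *)
Lemma cover_rank_ge (p0 : 'I_k) (E : {set B}) :
    (forall j, 0 < m j)%N -> (n < m p0)%N ->
    (forall S, S \in E -> exists C, [/\ exact_cover C, C p0 = S &
       forall j, j != p0 -> (#|C j| < m j)%N]) ->
  (\sum_(j < k | j != p0) #|D j| + #|E| <= r)%N.
Proof.
move=> m_gt0 m_p0 E_cover.
pose s := [seq j <- index_enum 'I_k | j != p0].
have p0s : p0 \notin s by rewrite mem_filter eqxx.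
have us : uniq s by rewrite filter_uniq // index_enum_uniq.
have [T [X [TX cardT]]] := killing_exists m_gt0 m_p0 us p0s.
have [T' [T'T cardT' _]] :=
  select_complement
    (fun w => @killing_nondegenerate _ _ _ _ _ w TX p0s E_cover).
rewrite -cardT' -big_filter -cardT.
by have := subset_leq_card T'T; have := cardsC T; rewrite card_ord; lia.
Qed.

End Core.

(** * Counting subsets by size, and the choice of degrees *)

Lemma card_small_sets n N :
  #|[set S : {set 'I_n} | (#|S| < N)%N]| = (\sum_(0 <= b < N) 'C(n, b))%N.
Proof.
elim: N => [|N IHN].
  by rewrite big_geq //; apply: eq_card0 => S; rewrite inE.
rewrite big_nat_recr //= -IHN -[X in 'C(X, _)]card_ord -card_draws -cardsUI.
rewrite (_ : _ :&: _ = set0) ?cards0 ?addn0.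
  by apply: eq_card => S; rewrite !inE ltnS leq_eqVlt orbC.
by apply/setP=> S; rewrite !inE; case: ltngtP.
Qed.

Lemma card_large_sets n N :
  (#|[set S : {set 'I_n} | (N <= #|S|)%N]| + \sum_(0 <= b < N) 'C(n, b)
     = 2 ^ n)%N.
Proof.
rewrite -card_small_sets (_ : [set S : {set 'I_n} | (#|S| < N)%N] =
  ~: [set S : {set 'I_n} | (N <= #|S|)%N]); last first.
  by apply/setP=> S; rewrite !inE ltnNge.
by rewrite cardsC -cardsT -powersetT card_powerset cardsT card_ord.
Qed.

Lemma cover_rank_binom (F : fieldType) (k n r m : nat)
    (f : 'I_r -> 'I_k -> {set 'I_n} -> F) :
    (3 <= k)%N -> (1 <= m)%N ->
    (forall S : 'I_k -> {set 'I_n},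
       \sum_i \prod_j f i j (S j) = (exact_cover S)%:R) ->
  (k.-1 * 2 ^ n + \sum_(0 <= b < (2 * m - 2).+1) 'C(n, b)
     <= r + 2 * \sum_(0 <= b < m) 'C(n, b) + (k - 3))%N.
Proof.
case: k f => [|[|[|k]]] // f _ m_gt0 f_cover.
pose p0 : 'I_k.+3 := Ordinal (isT : (0 < k.+3)%N).
pose p1 : 'I_k.+3 := Ordinal (isT : (1 < k.+3)%N).
pose p2 : 'I_k.+3 := Ordinal (isT : (2 < k.+3)%N).
pose mu (j : 'I_k.+3) := nth 1%N [:: n.+1; m; m] j.
(* A complement of at most [2 * m - 2] elements splits into two sets of at most [m - 1], for [p1]
   and [p2]. *)
pose E := [set S : {set 'I_n} | (#|~: S| < (2 * m - 2).+1)%N].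
have cardE : #|E| = (\sum_(0 <= b < (2 * m - 2).+1) 'C(n, b))%N.
  rewrite -card_small_sets -(card_imset _ (@setC_inj 'I_n)).
  apply: eq_card => S; rewrite !inE; apply/imsetP/idP => [[C]|Sm].
    by rewrite inE => Cm ->.
  by exists (~: S); rewrite ?inE setCK.
have mu_gt0 j : (0 < mu j)%N by case: j => [[|[|[|[]]]]].
have E_cover S : S \in E -> exists C, [/\ exact_cover C, C p0 = S &
    forall j, j != p0 -> (#|C j| < mu j)%N].
  rewrite inE ltnS => Sm.
  have [A AS cardA] : exists2 A : {set 'I_n},
      A \subset ~: S & #|A| = minn #|~: S| m.-1.
    have /set0Pn[A] : [set A : {set 'I_n} |
        (A \subset ~: S) && (#|A| == minn #|~: S| m.-1)] != set0.
      by rewrite -card_gt0 cards_draws bin_gt0 geq_minl.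
    by rewrite inE => /andP[? /eqP]; exists A.
  pose g l := if l \in S then p0 else if l \in A then p1 else p2.
  exists (fun j => [set l | g l == j]); split; first exact: exact_cover_fibers.
    by apply/setP=> l; rewrite inE /g; case: (l \in S) => //; case: ifP.
  move=> j jp0.
  have [->|jp1] := eqVneq j p1.
    rewrite (_ : [set _ | _] = A); first by rewrite cardA /mu /=; lia.
    apply/setP=> l; rewrite inE /g; case: ifP => lS; last by case: ifP.
    by apply/esym/negP => /(subsetP AS); rewrite inE lS.
  have [->|jp2] := eqVneq j p2.
    rewrite (_ : [set _ | _] = (~: S) :\: A).
      rewrite cardsD (setIidPr AS) cardA /mu /=; move: Sm m_gt0; clear.
      by move: #|~: S| => x; lia.
    by apply/setP=> l; rewrite !inE /g; case: (l \in S); case: (l \in A).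
  rewrite (_ : [set _ | _] = set0) ?cards0 //; apply/setP=> l; rewrite !inE /g.
  by do 2?[case: ifP => _];
    rewrite eq_sym ?(negbTE jp0) ?(negbTE jp1) ?(negbTE jp2).
have := cover_rank_ge f_cover (p0 := p0) mu_gt0 (ltnSn n) E_cover.
rewrite cardE big_mkcond !big_ord_recl /= /mu /=.
rewrite (eq_bigr (fun=> (2 ^ n).-1)) => [|j _].
  rewrite sum_nat_const card_ord.
  have := card_large_sets n m; have : (0 < 2 ^ n)%N by rewrite expn_gt0.
  move: (2 ^ n)%N #|_| (bigop.body _ _ _) (bigop.body _ _ _); clear.
  by move=> [//|x] a s t _ a_s; nia.
by have := card_large_sets n 1; rewrite big_nat1 bin0 /= nth_nil; lia.
Qed.

(** * Coordinates of the Kronecker powers of W *)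

Section KronW.
Variables (F : fieldType) (k : nat).
Local Notation idx n := (kron_exp_index (fun _ : 'I_k => 'I_2) n).

Lemma W_tensorE (b : 'I_k -> bool) :
  W_tensor F k [ffun j => if b j then 1 else 0]
    = ((\sum_(j < k) b j)%N == 1%N)%:R.
Proof.
have W_prod : W_tensor F k [ffun j => if b j then 1 else 0]
    = \sum_i \prod_j (b j == (j == i))%:R.
  rewrite /W_tensor sum_ffunE; apply: eq_bigr => i _.
  rewrite ffunE; apply: eq_bigr => j _; rewrite !ffunE.
  by case: (b j); case: (j == i).
rewrite W_prod; have [/eqP/sum_nat_eq1[i [_ bi bn]]|nb] := eqVneq.
  rewrite (bigD1 i) //= big1 => [|j _]; last first.
    have [->|ji] := eqVneq j i; first by move: bi; case: (b i).
    by have := bn j ji isT; case: (b j).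
  rewrite big1 ?addr0 // => j /negbTE ji.
  rewrite (bigD1 i) //= [i == j]eq_sym ji.
  by move: bi; case: (b i) => //; rewrite mul0r.
rewrite big1 // => i _; apply/eqP/prodf_eq0.
case: (pickP (fun j => b j != (j == i))) => [j bj|bE].
  by exists j; rewrite ?(negbTE bj).
case/negP: nb; apply/sum_nat_eq1; exists i.
have {}bE j : b j = (j == i) by apply/eqP/negbFE/bE.
by split=> // [|j /negbTE ji _]; rewrite bE ?eqxx ?ji.
Qed.

(** The bits come from a function on [nat], which the recursion can shift without casts between
    ordinals. *)
Fixpoint kron_point (n : nat) (j : 'I_k) (b : nat -> bool) : idx n j :=
  match n return idx n j with
  | 0 => tt
  | n'.+1 => (if b 0%N then 1 else 0, kron_point n' j (fun l => b l.+1))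
  end.

(** Kronecker products multiply entries, so each bit position contributes one entry of W. *)
Lemma kron_exp_WE n (b : 'I_k -> nat -> bool) :
  kron_exp (W_tensor F k) n [ffun j => kron_point n j (b j)]
    = [forall l : 'I_n, (\sum_(j < k) b j l)%N == 1%N]%:R.
Proof.
suff -> : kron_exp (W_tensor F k) n [ffun j => kron_point n j (b j)]
    = \prod_(l < n) ((\sum_(j < k) b j l)%N == 1%N)%:R.
  case: forallP => [b1|b1]; first by rewrite big1 // => l _; rewrite b1.
  apply/eqP/prodf_eq0/exists_inP; apply: contra_notT b1.
  rewrite negb_exists => /forallP b1 l; have := b1 l.
  by case: (_ == 1%N); rewrite ?eqxx.
elim: n b => [|n IHn] b; first by rewrite big_ord0 ffunE.
rewrite big_ord_recl -W_tensorE -(IHn (fun j l => b j l.+1)) /= ffunE.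
by congr (_ * _); f_equal; apply/ffunP=> j; rewrite !ffunE.
Qed.

(** A shortest decomposition, read in subset coordinates, supplies the [f] of [cover_rank_binom]. *)
Lemma kron_exp_W_rank_ge n m : (3 <= k)%N -> (1 <= m)%N ->
  (k.-1 * 2 ^ n + \sum_(0 <= b < (2 * m - 2).+1) 'C(n, b)
     <= tensor_rank (kron_exp (W_tensor F k) n)
        + 2 * \sum_(0 <= b < m) 'C(n, b) + (k - 3))%N.
Proof.
move=> k_ge3 m_gt0.
have [[s [s_simple W_s]] _] :=
  tensor_rankP (kron_exp (W_tensor F k) n) (ltnW (ltnW k_ge3)).
have [v s_v] := choice s_simple.
pose bits (S : {set 'I_n}) l := l \in [seq val i | i in S].
apply: (cover_rank_binom
  (f := fun i j S => v i j (kron_point n j (bits S)))) => // S.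
have -> : exact_cover S =
    [forall l : 'I_n, (\sum_(j < k) bits (S j) l)%N == 1%N].
  apply: eq_forallb => l; congr (_ == _); apply: eq_bigr => j _.
  by rewrite /bits mem_map ?mem_enum //; apply: val_inj.
rewrite -(kron_exp_WE n (fun j => bits (S j))) [in RHS]W_s sum_ffunE.
apply: eq_bigr => i _.
by rewrite s_v ffunE; apply: eq_bigr => j _; rewrite ffunE.
Qed.

End KronW.

(** * Binomial sums and their variance *)

(** Pascal's rule, summed against a weight. *)
Lemma sum_binS (R : pzRingType) n (g : nat -> R) :
  \sum_(0 <= b < n.+2) 'C(n.+1, b)%:R * g b
    = \sum_(0 <= b < n.+1) 'C(n, b)%:R * (g b + g b.+1).
Proof.
rewrite big_nat_recl // bin0; under eq_bigr => b _ do rewrite binS natrD mulrDl.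
rewrite big_split /= addrA; under [RHS]eq_bigr => b _ do rewrite mulrDr.
rewrite [RHS]big_split /=; congr (_ + _).
rewrite -[X in X * _]/(1%:R) -(bin0 n).
rewrite -(big_nat_recl n.+1 0 (fun b => 'C(n, b)%:R * g b)) //.
by rewrite big_nat_recr //= bin_small // mul0r addr0.
Qed.

Lemma sum_bin n : (\sum_(0 <= b < n.+1) 'C(n, b) = 2 ^ n)%N.
Proof.
rewrite -[RHS](card_large_sets n n.+1) [X in (X + _)%N]eq_card0 // => S.
by rewrite !inE; apply: contraTF (max_card (mem S)); rewrite card_ord -ltnNge.
Qed.

(** Up to the factor [2 ^+ n], the variance of a sum of [n] independent signs. The induction rests
    on (x - 1)^2 + (x + 1)^2 = 2x^2 + 2 for x = 2b - n. *)
Lemma sum_bin_variance n :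
  \sum_(0 <= b < n.+1) 'C(n, b)%:R * (2 * b%:R - n%:R : int) ^+ 2
    = n%:R * 2 ^+ n.
Proof.
elim: n => [|n IHn]; first by rewrite big_nat1.
rewrite sum_binS.
rewrite (eq_bigr (fun b =>
  2 * ('C(n, b)%:R * (2 * b%:R - n%:R) ^+ 2) + 2 * 'C(n, b)%:R)).
  rewrite big_split /= -!mulr_sumr IHn -natr_sum sum_bin natrX exprS; ring.
by move=> b _; rewrite -[n.+1]addn1 -[b.+1]addn1 !natrD; ring.
Qed.

Lemma sum_bin_le n N : (\sum_(0 <= b < N) 'C(n, b) <= 2 ^ n)%N.
Proof. by rewrite -(card_large_sets n N) leq_addl. Qed.

From mathcomp Require Import classical_sets filter reals topology.
From mathcomp Require Import normedtype landau.
From mathcomp Require Import complex.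

Import numFieldNormedType.Exports.

(** * The maximal binomial gap and its size *)

Lemma binom_gap_le n m : binom_gap n m <= 2 ^+ n.
Proof.
rewrite /binom_gap; have := sum_bin_le n (2 * m - 2).+1.
have -> : (2 ^+ n : int) = (2 ^ n)%N%:Z by rewrite -natrX natz.
by move: (2 ^ n)%N (bigop.body _ _ _) (bigop.body _ _ _) => N a b; lia.
Qed.

(** Infinitely many [m] compete, but the values are integers bounded by [2 ^+ n], so some distance
    [d] to this bound is least. *)
Lemma binom_gap_max n :
  exists M,
    is_max [set binom_gap n m | m in [set m : nat | (1 <= m)%N]]%classic M.
Proof.
pose P d := `[< exists2 m, (1 <= m)%N & binom_gap n m = 2 ^+ n - d%:Z >].
have exP : exists d, P d.
  exists `|2 ^+ n - binom_gap n 1|%N; apply/asboolP; exists 1%N => //.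
  by have := binom_gap_le n 1; lia.
case: (ex_minnP exP) => d /asboolP[m m_gt0 dm] d_min.
exists (2 ^+ n - d%:Z); split; first by exists m.
move=> _ [m' m'_gt0 <-]; have := d_min `|2 ^+ n - binom_gap n m'|%N.
have le := binom_gap_le n m'.
suff P' : P `|2 ^+ n - binom_gap n m'|%N by move=> /(_ P'); lia.
by apply/asboolP; exists m' => //; lia.
Qed.

Lemma binom_gap_ge n : (4 <= n)%N ->
  n%:Z * (2 ^+ n - binom_gap n (n %/ 3).+1) <= 72 * 2 ^+ n.
Proof.
move=> n_ge4; set m := (n %/ 3).+1.
(* The weight of degree [b] in the deficit: degrees above [2 * m - 2] are missed once, those below
   [m] are subtracted twice. *)
pose c b : int := (~~ (b < (2 * m - 2).+1)%N)%:R + 2 * (b < m)%:R.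
have n_m : ((2 * m - 2).+1 <= n.+1)%N by lia.
have gapE : 2 ^+ n - binom_gap n m = \sum_(0 <= b < n.+1) 'C(n, b)%:R * c b.
  have widen N : (N <= n.+1)%N ->
      (\sum_(0 <= b < N) 'C(n, b))%:Z
        = \sum_(0 <= b < n.+1) 'C(n, b)%:R * (b < N)%:R.
    move=> le.
    rewrite (big_nat_widen _ _ _ _ _ le) big_mkcond /= -natz natr_sum.
    by apply: eq_bigr => b _; case: (b < N)%N; rewrite ?mulr1 ?mulr0.
  have -> : (2 ^+ n : int) = \sum_(0 <= b < n.+1) 'C(n, b)%:R * 1.
    by under eq_bigr => b _ do rewrite mulr1; rewrite -natr_sum sum_bin natrX.
  rewrite /binom_gap !widen //; last by lia.
  rewrite mulr_sumr -!sumrB; apply: eq_bigr => b _.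
  rewrite /c (_ : (m - 1).+1 = m); last by lia.
  by case: (b < _)%N; case: (b < m)%N => /=; ring.
rewrite -(ler_pM2l (_ : 0 < n%:Z)) ?gapE; last by lia.
rewrite (_ : n%:Z * (72 * 2 ^+ n) = 72 * (n%:R * 2 ^+ n)); last by ring.
rewrite -sum_bin_variance !mulr_sumr; apply: ler_sum => b _.
have C_ge0 : 0 <= ('C(n, b)%:R : int) by rewrite ler0n.
(* Where [c b] is nonzero, n <= 6|2b - n|; since [c b] is at most 2, the constant 72 = 2 * 6^2
   suffices. *)
have c_le : n%:Z * (n%:Z * c b) <= 72 * (2 * b%:R - n%:R) ^+ 2.
  rewrite /c !natz; case: ltnP => b_up; case: ltnP => b_low /=; nia.
nia.
Qed.

(** * The rank bound and its asymptotic form *)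

Local Open Scope classical_set_scope.

Theorem theorem11 (R : realType) (k : nat) (hk : (3 <= k)%N) :
  exists M : nat -> int,
    (forall n : nat, (1 <= n)%N ->
       is_max [set binom_gap n m | m in [set m : nat | (1 <= m)%N]] (M n) /\
       W_bound k n (M n)
         <= (tensor_rank (kron_exp (W_tensor (complex R) k) n))%:Z) /\
    exists f : nat -> R,
      f =o_\oo (fun n : nat => 2 ^+ n : R) /\
      forall n : nat, (1 <= n)%N ->
        k%:R * 2 ^+ n - f n <= (W_bound k n (M n))%:~R.
Proof.
have [M M_max] := choice binom_gap_max.
exists M; split=> [n _|].
  split=> //; have [[m m_gt0 <-] _] := M_max n.
  have := @kron_exp_W_rank_ge (complex R) k n m hk m_gt0.
  rewrite /W_bound /binom_gap (_ : (m - 1).+1 = m); last first.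
    by rewrite subn1 prednK.
  have -> : (2 ^+ n : int) = (2 ^ n)%N%:Z by rewrite -natrX natz.
  move: (2 ^ n)%N (tensor_rank _) (bigop.body _ _ _) (bigop.body _ _ _).
  move=> N r a b.
  by move: hk; clear; case: k => [|[|[|q]]] //= _; nia.
(* Taking the exact deficit as error term leaves only its growth to be bounded. *)
pose f n := k%:Z * 2 ^+ n - W_bound k n (M n).
have fE n : f n = 2 ^+ n - M n + (k%:Z - 3) by rewrite /f /W_bound; ring.
have f_ge0 n : 0 <= f n.
  rewrite fE; have [[m _ <-] _] := M_max n; have := binom_gap_le n m.
  by move: (2 ^+ n : int) (binom_gap n m) => N a; clear -hk; lia.
(* The 72 comes from [binom_gap_ge]; the summand [k - 3] is absorbed through n <= 2^n. *)
have f_le n : (4 <= n)%N -> n%:Z * f n <= (72 + k%:Z) * 2 ^+ n.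
  move=> n_ge4; have := binom_gap_ge n_ge4.
  have /(M_max n).2 : [set binom_gap n m | m in [set m : nat | (1 <= m)%N]]
      (binom_gap n (n %/ 3).+1) by exists (n %/ 3).+1.
  have : n%:Z <= 2 ^+ n.
    by rewrite -natz -(natrX _ 2) ler_nat ltnW // ltn_expl.
  rewrite fE; move: (2 ^+ n : int) (binom_gap n _) (M n) => N a b; clear -hk.
  nia.
exists (fun n => (f n)%:~R); split=> [|n _]; last first.
  by rewrite /f !rmorphB !rmorphM /= rmorphXn /= opprB addrC subrK.
apply/eqoP => e e_gt0; near=> n.
have n_ge4 : (4 <= n)%N by near: n; exact: nbhs_infty_ge.
have n_gt : (72 + k%:R) / e < n%:R by near: n; exact: nbhs_infty_gtr.
rewrite !ger0_norm ?ler0z ?exprn_ge0 //.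
have n_gt0 : 0 < n%:R :> R by rewrite ltr0n; lia.
rewrite -(ler_pM2l n_gt0).
have := f_le n n_ge4; rewrite -(ler_int R) !rmorphM /= rmorphD rmorphXn /=.
move=> /le_trans; apply; rewrite mulrA ler_wpM2r ?exprn_ge0 //.
by rewrite intrD -ler_pdivrMr ?ltW.
Unshelve. all: by end_near.
Qed.
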